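(* Let $X=(X_1,\dots,X_m)$ be a random vector with continuous marginals $F_1,\dots,F_m$, let $Y_j:=-\log(1-F_j(X_j))$, $V_j:=(1-F_j(X_j))^{-1}$, $Y:=(Y_1,\dots,Y_m)$, and let $I$ be a rate function. (a) Assume that the LDP $$-\inf I(A^{o})\le\liminf_{y\to\infty}\frac1y\log P(Y/y\in A)\le\limsup_{y\to\infty}\frac1y\log P(Y/y\in A)\le-\inf I(\bar A)$$ holds for every Borel set $A\subset[0,\infty)^m$. Then to any Borel set $A\subset\mathbb{R}^m$ which is a continuity set of $I$ and for which $y\mapsto-\log P(Y/y\in A)$ satisfies the Von Mises condition, the following limit relation applies: $$\lim_{t\to\infty}\frac{P(Y\in A\log(t\lambda))}{P(Y\in A\log t)}=\lambda^{-\inf I(A)}\qquad\forall\lambda>0,\qquad( ** )$$ with $I$ satisfying $I(x\lambda)=\lambda I(x)$ for all $\lambda>0$, $x\in\mathbb{R}^m$; $\inf_{x\in\mathbb{R}^m:\,x_j>\lambda}I(x)=\lambda$ for all $\lambda\ge0$, $j\in\{1,\dots,m\}$; and $I(0)=0$. In particular, for every $a\in[0,\infty)^m$ such that the function $y\mapsto-\log P(Y_j>ya_j\ \forall j\in\{1,\dots,m\})$ satisfies the Von Mises condition, $$\lim_{t\to\infty}\frac{P(V_j>(t\lambda)^{a_j}\ \forall j\in\{1,\dots,m\})}{P(V_j>t^{a_j}\ \forall j\in\{1,\dots,m\})}=\lambda^{-\inf I(A_a)}\qquad\forall\lambda>0,$$ where $A_a:=\{x\in\mathbb{R}^m:\ x_j>a_j\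 \forall j\in\{1,\dots,m\}\}$. (b) If $A\subset\mathbb{R}^m$ is a Borel set for which $( ** )$ holds with $\inf I(A)\in(0,\infty)$, then $$\lim_{y\to\infty}\frac1y\log P(Y\in Ay)=-\inf I(A).$$
   Context: A rate function is a lower semicontinuous function with values in $[0,\infty]$; $\inf I(S):=\inf_{x\in S}I(x)$, $\inf\emptyset:=\infty$, $\log0:=-\infty$. The LDP is on the topological space $[0,\infty)^m$ (interior and closure in the LDP are taken in $[0,\infty)^m$), and $I(x)=\infty$ whenever $\min_jx_j<0$. A set $A\subset\mathbb{R}^m$ is a continuity set of $I$ if $\inf I(A^o)=\inf I(\bar A)$ (interior and closure in $\mathbb{R}^m$). Every regularly varying function $f$ of index $\alpha\in\mathbb{R}$ can be written as $f(y)=c(y)\exp\left(\int_{y_0}^y a(t)t^{-1}dt\right)$ with $c(y)\to c_0>0$ and $a(y)\to\alpha$ as $y\to\infty$. Such an $f$ satisfies the Von Mises condition if $c$ can be taken equal to a positive constant $c_0$; in particular $f$ is then differentiable with $f'(y)=a(y)f(y)/y$.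
   Formalization: In the ''in particular'' clause of (a), when some a_j = 0 the set A_a is additionally assumed to be a continuity set of I; without this the clause is false, e.g. for X = (U, 1−U) with U uniform and a = (1,0). *)

(* Defs.v *)
From HB Require Import structures.
From mathcomp Require Import all_boot all_order all_algebra.
From mathcomp Require Import all_classical all_reals all_analysis.
Set Implicit Arguments.
Unset Strict Implicit.
Unset Printing Implicit Defensive.
Import Order.TTheory GRing.Theory Num.Theory.
Import numFieldNormedType.Exports.
Local Open Scope classical_set_scope.
Local Open Scope ring_scope.

Definition borel (T : topologicalType) : set_system T := <<s @open T >>.

Definition orthant (R : realType) (m : nat) : set 'rV[R]_m :=
  [set x | forall j, 0 <= x 0 j].
Arguments orthant : clear implicits.

Definition rate_function (R : realType) (T : topologicalType)
    (I : T -> \bar R) : Prop :=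
  (forall x, (0 <= I x)%E) /\ lower_semicontinuous I.

Definition inf_on (R : realType) (T : Type) (I : T -> \bar R) (A : set T) :
    \bar R := ereal_inf (I @` A).

Definition continuity_set (R : realType) (T : topologicalType)
    (I : T -> \bar R) (A : set T) : Prop :=
  inf_on I (interior A) = inf_on I (closure A).

(* lambda ^ s for lambda > 0 and s in [-oo, +oo], as exp (s log lambda). As
   0 * +-oo = 0, for s = -oo this is 0, 1 or +oo according as lambda > 1,
   lambda = 1 or lambda < 1; for real s it is the real power. *)
Definition epow (R : realType) (lambda : R) (s : \bar R) : \bar R :=
  expeR (s * (ln lambda)%:E)%E.

(* Constancy of c and a --> alpha already make f regularly varying of index
   alpha. The exponent a is only required to be (Lebesgue) integrable against
   dt/t on compact intervals, the least for the formula to make sense;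
   f' y = a y * f y / y then holds at almost every y, and at every y > y0
   where a is continuous. f takes values in \bar R because it will be of the
   form - log P(...); the formula forces it to be real and positive on
   [y0, +oo[. *)
Definition von_mises (R : realType) (f : R -> \bar R) : Prop :=
  exists (alpha y0 c0 : R) (a : R -> R),
    [/\ 0 < y0, 0 < c0,
        a y @[y --> +oo] --> alpha,
        (forall y, y0 <= y -> (@lebesgue_measure R).-integrable `[y0, y]
                                (fun t => (a t / t)%:E))
      & forall y, y0 <= y ->
          f y = (c0 * expR (\int[@lebesgue_measure R]_(t in `[y0, y])
                              (a t / t)))%:E].

Section RandomVector.
Context (d : measure_display) (T : measurableType d) (R : realType).
Context (P : probability T R) (m : nat).

(* 1 - F_j (X_j); when F_j is continuous it vanishes with probability 0 only,
   so the values ln 0 = 0 and 0^-1 = 0 used by the library in Yvec and Vvec below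
   do not affect any probability. *)
Definition survival (X : 'I_m -> {RV P >-> R}) (j : 'I_m) (w : T) : R :=
  1 - fine (cdf (X j) (X j w)).

Definition Yvec (X : 'I_m -> {RV P >-> R}) (w : T) : 'rV[R]_m :=
  \row_j - ln (survival X j w).

Definition Vvec (X : 'I_m -> {RV P >-> R}) (w : T) : 'rV[R]_m :=
  \row_j (survival X j w)^-1.

Definition scale_set (y : R) (A : set 'rV[R]_m) : set 'rV[R]_m :=
  [set y *: x | x in A].

(* Large deviation principle, with speed y, on the space [0, oo)^m: interior
   and closure are those of the subspace topology. lne 0 = -oo. *)
Definition LDP (Y : T -> 'rV[R]_m) (I : 'rV[R]_m -> \bar R) : Prop :=
  forall A : set 'rV[R]_m, borel A -> A `<=` orthant R m ->
    let logP y := (y^-1%:E * lne (P [set w | A (y^-1 *: Y w)]))%E in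
    [/\ (- inf_on I (interior (A : set (subspace (orthant R m)))) <=
           limf_einf logP (pinfty_nbhs R))%E,
        (limf_einf logP (pinfty_nbhs R) <= limf_esup logP (pinfty_nbhs R))%E
      & (limf_esup logP (pinfty_nbhs R) <=
           - inf_on I (closure (A : set (subspace (orthant R m)))))%E].

(* P(Y in A log(t lambda)) / P(Y in A log t) --> lambda ^ - inf I(A). The limit
   is taken in \bar R, since inf I(A) may be +oo. *)
Definition tail_limit (Y : T -> 'rV[R]_m) (I : 'rV[R]_m -> \bar R)
    (A : set 'rV[R]_m) : Prop :=
  forall lambda : R, 0 < lambda ->
    (fine (P (Y @^-1` scale_set (ln (t * lambda)) A)) /
     fine (P (Y @^-1` scale_set (ln t) A)))%:E
      @[t --> +oo] --> epow lambda (- inf_on I A)%E.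

End RandomVector.

Definition open_orthant_above (R : realType) (m : nat) (a : 'rV[R]_m) :
    set 'rV[R]_m := [set x | forall j, a 0 j < x 0 j].

(* Main.v *)
Require Import Defs.
From mathcomp Require Import all_boot all_order all_algebra.
From mathcomp Require Import all_classical all_reals all_analysis.
From mathcomp Require Import measurable_realfun ring lra.
Import Order.TTheory GRing.Theory Num.Theory.
Import numFieldNormedType.Exports.
Local Open Scope classical_set_scope.
Local Open Scope ring_scope.

(** The exponent [s = inf I(A)] enters through one function of one variable,
    [f y = - log P(Y/y \in A)], and the theorem compares two asymptotic
    statements about it: [f y / y --> s], and [f (y + h) - f y --> s h] for
    every [h]. With [y = log t] and [h = log lambda], the second one is the
    tail limit relation in logarithmic form.

    From the LDP to the tail limit. The vector [Y] lives in the orthant and [I]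
    is infinite off it, so that for a continuity set both LDP bounds coincide
    and [f y / y --> s] ([LDP_continuity_set]). The Von Mises condition says
    [f = c exp Phi] with [Phi z - Phi y] close to [alpha (log z - log y)]
    ([log_index]). Hence
      [f (y + h) - f y = (f y / y) (y (exp (Phi (y + h) - Phi y) - 1))],
    where the last factor tends to [alpha h], and it remains to see that
    [s alpha = s]: [f y / y] tends to [0] if [alpha < 1] and to [+oo] if
    [alpha > 1] ([exp_log_index_limit]).

    Properties of [I]. For [lambda > 0], [Y/y] is in [lambda B] iff
    [Y/(lambda y)] is in [B], so the decay rates of the two events differ by the
    factor [lambda]; small closed neighbourhoods [B] of [x] and lower
    semicontinuity turn this into [I (lambda x) = lambda I x]
    ([LDP_rate_scale_ge]). As the marginals are continuous, [F_j (X_j)] is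
    uniform and [P(Y_j > s) = exp (- s)], which determines the infimum of [I] on
    half-spaces ([rate_inf_halfspace]). Some [x] then has [I x < 1], and
    [I (k x) = k I x] with [k --> 0] gives [I 0 = 0]. If all [a_j] are positive,
    [A_a] is a continuity set because [(1 + e) x] is in [A_a] for [x] in its
    closure and [I ((1 + e) x) = (1 + e) I x].

    From the tail limit to the log asymptotics. Here
    [k y = log P(Y \in y A) + s y] satisfies [k (y + u) - k y --> 0] for every
    [u], and [k y / y --> 0] is wanted. Without regularity of [k] this fails, but
    [k] is measurable by Fubini, so the uniform convergence theorem of Karamata's
    theory applies: the convergence is uniform for [u] in [[0, 1]]
    ([slow_uniform]), and telescoping over unit steps gives the claim
    ([slow_sublinear]). *)

Set Implicit Arguments.
Unset Strict Implicit.
Unset Printing Implicit Defensive.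

(** * Karamata integrals and the Von Mises condition *)

Lemma integrable_inv (R : realType) (y z : R) : 0 < y ->
  (@lebesgue_measure R).-integrable `[y, z] (EFin \o (fun t => t^-1)).
Proof.
move=> y0.
apply: continuous_compact_integrable; first exact: segment_compact.
apply: continuous_in_subspaceT => x; rewrite inE/= in_itv/= => /andP[yx _].
by apply: continuousV => //; rewrite gt_eqF// (lt_le_trans y0).
Qed.

Lemma Rintegral_inv (R : realType) (y z : R) : 0 < y -> y <= z ->
  \int[@lebesgue_measure R]_(t in `[y, z]) t^-1 = ln z - ln y.
Proof.
move=> y0; rewrite le_eqVlt => /predU1P[<-|yz].
  by rewrite set_itv1 Rintegral_set1 subrr.
have z0 := lt_trans y0 yz.
rewrite /Rintegral (@continuous_FTC2 _ _ (@ln R))//.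
- apply: continuous_in_subspaceT => x; rewrite inE/= in_itv/= => /andP[yx _].
  by apply: continuousV => //; rewrite gt_eqF// (lt_le_trans y0).
- split.
  + move=> x; rewrite in_itv/= => /andP[yx _].
    by apply: ex_derive; apply: is_derive1_ln; exact: lt_trans yx.
  + by apply: cvg_at_right_filter; exact: continuous_ln.
  + by apply: cvg_at_left_filter; exact: continuous_ln.
- move=> x; rewrite in_itv/= => /andP[yx _].
  by rewrite derive1E; apply: derive_val; apply: is_derive1_ln; exact: lt_trans yx.
Qed.

(** Since [dt/t] integrates to [log], an integrand [a t / t] with [a] close to
    [alpha] integrates to nearly [alpha (log z - log y)]. *)
Lemma Rintegral_karamata (R : realType) (a : R -> R) (alpha eps y z : R) :
  0 < y -> y <= z ->
  (@lebesgue_measure R).-integrable `[y, z] (fun t => (a t / t)%:E) ->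
  (forall t, y <= t <= z -> `|a t - alpha| <= eps) ->
  `|\int[@lebesgue_measure R]_(t in `[y, z]) (a t / t) - alpha * (ln z - ln y)|
    <= eps * (ln z - ln y).
Proof.
move=> y0 yz ia ha.
have iv b : (@lebesgue_measure R).-integrable `[y, z] (EFin \o (fun t => b * t^-1)).
  by apply: (integrableZl _ _ (integrable_inv z y0)).
have E b : b * (ln z - ln y) = \int[@lebesgue_measure R]_(t in `[y, z]) (b * t^-1).
  by rewrite RintegralZl ?Rintegral_inv//; exact: integrable_inv.
have t0 t : `[y, z]%classic t -> 0 < t^-1.
  by rewrite /= in_itv/= invr_gt0 => /andP[/(lt_le_trans y0)].
have up : \int[@lebesgue_measure R]_(t in `[y, z]) (a t / t) <= (alpha + eps) * (ln z - ln y).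
  rewrite E; apply: le_Rintegral => //= t yzt.
  rewrite ler_pM2r ?t0//; have := ha t; rewrite in_itv/= in yzt.
  by move=> /(_ yzt); rewrite ler_norml => /andP[]; lra.
have lo : (alpha - eps) * (ln z - ln y) <= \int[@lebesgue_measure R]_(t in `[y, z]) (a t / t).
  rewrite E; apply: le_Rintegral => //= t yzt.
  rewrite ler_pM2r ?t0//; have := ha t; rewrite in_itv/= in yzt.
  by move=> /(_ yzt); rewrite ler_norml => /andP[]; lra.
rewrite ler_norml; apply/andP; split; nra.
Qed.

(** [exp (Phi y)] behaves like a normalised regularly varying function of index
    [alpha]. Keeping [log z - log y] in the error bound is what makes the estimate
    useful both for [z = y + h], where the error is [o(1/y)], and for [z] far
    from [y]. *)
Definition log_index (R : realType) (Phi : R -> R) (alpha : R) : Prop :=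
  forall eps, 0 < eps -> exists2 Y, 0 < Y & forall y z, Y <= y -> y <= z ->
    `|Phi z - Phi y - alpha * (ln z - ln y)| <= eps * (ln z - ln y).

Lemma log_index_Rintegral (R : realType) (a : R -> R) (alpha y0 : R) :
  0 < y0 -> a y @[y --> +oo] --> alpha ->
  (forall y, y0 <= y ->
    (@lebesgue_measure R).-integrable `[y0, y] (fun t => (a t / t)%:E)) ->
  log_index (fun y => \int[@lebesgue_measure R]_(t in `[y0, y]) (a t / t)) alpha.
Proof.
move=> y00 /cvgrPdist_le ha ia eps /ha [M [_ hM]].
exists (Num.max y0 (M + 1)); first by rewrite lt_max y00.
move=> y z; rewrite ge_max => /andP[y0y My] yz.
rewrite Rintegral_itvB ?bnd_simp//; last exact: (ia z (le_trans y0y yz)).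
have iyz : (@lebesgue_measure R).-integrable `[y, z] (fun t => (a t / t)%:E).
  apply: integrableS (ia z (le_trans y0y yz)) => //.
  by apply: subset_itv => //; rewrite bnd_simp.
have yp := lt_le_trans y00 y0y.
rewrite Rintegral_itv_obnd_cbnd//; last first.
  by apply: integrableS iyz => //; apply: subset_itvr; rewrite bnd_simp.
apply: Rintegral_karamata => // t /andP[yt tz].
by rewrite distrC; apply: hM; lra.
Qed.

Lemma ln_increment_bounds (R : realType) (y h : R) : 0 < y -> 0 <= h ->
  h / (y + h) <= ln (y + h) - ln y <= h / y.
Proof.
move=> y0 h0; have yh0 : 0 < y + h by rewrite ltr_wpDr.
rewrite -ln_div ?posrE//; apply/andP; split; last first.
  have -> : (y + h) / y = 1 + h / y by field; rewrite gt_eqF.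
  by apply: le_ln1Dx; rewrite (lt_le_trans (ltrN10 R))// divr_ge0// ltW.
rewrite -[X in _ <= ln X]invrK lnV ?posrE ?invr_gt0 ?divr_gt0// lerNr.
have -> : ((y + h) / y)^-1 = 1 + - (h / (y + h)).
  by field; rewrite !gt_eqF.
by apply: le_ln1Dx; rewrite ltrN2 ltr_pdivrMr// mul1r ltrDr.
Qed.

(** [y (log (y + h) - log y)] tends to [h], and the error allowed by
    [log_index] is a small multiple of the same quantity. *)
Lemma log_index_increment (R : realType) (Phi : R -> R) (alpha h : R) :
  log_index Phi alpha -> 0 <= h ->
  y * (Phi (y + h) - Phi y) @[y --> +oo] --> alpha * h.
Proof.
move=> HPhi h0; apply/cvgrPdist_le => e e0.
have h1 : 0 < h + 1 by rewrite ltr_wpDl.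
have [Y Y0 HY] := HPhi (e / 2 / (h + 1)) ltac:(by rewrite !divr_gt0).
near=> y.
have Yy : Y <= y by near: y; apply: nbhs_pinfty_ge; exact: num_real.
have y0 : 0 < y := lt_le_trans Y0 Yy.
have yB : `|alpha| * h ^+ 2 / (e / 2) <= y by near: y; apply: nbhs_pinfty_ge; exact: num_real.
have /andP[lo up] := ln_increment_bounds y0 h0.
have := HY y (y + h) Yy ltac:(by rewrite lerDl).
set D := Phi _ - _; set L := ln _ - ln _ in lo up *.
have yL1 : y * L <= h by rewrite mulrC -ler_pdivlMr.
have yL2 : h - h ^+ 2 / y <= y * L.
  have : y * (h / (y + h)) <= y * L by rewrite ler_pM2l.
  apply: le_trans; rewrite -subr_ge0.
  have -> : y * (h / (y + h)) - (h - h ^+ 2 / y) = h ^+ 3 / (y * (y + h)).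
    by field; rewrite !gt_eqF// ltr_wpDr.
  by rewrite divr_ge0 ?exprn_ge0// mulr_ge0 ?addr_ge0// ltW.
move=> HD.
have -> : alpha * h - y * D = alpha * (h - y * L) - y * (D - alpha * L) by ring.
apply: le_trans (ler_normB _ _) _; rewrite !normrM (gtr0_norm y0) (splitr e).
apply: lerD.
  rewrite (ger0_norm (_ : 0 <= h - y * L)) ?subr_ge0//.
  apply: (@le_trans _ _ (`|alpha| * (h ^+ 2 / y))).
    by apply: ler_wpM2l => //; lra.
  have e20 : 0 < e / 2 by rewrite divr_gt0.
  by rewrite mulrA ler_pdivrMr// [leRHS]mulrC -ler_pdivrMr.
apply: (@le_trans _ _ (y * (e / 2 / (h + 1) * L))); first by rewrite ler_pM2l.
have -> : y * (e / 2 / (h + 1) * L) = (e / 2) * ((y * L) / (h + 1)).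
  by field; rewrite gt_eqF.
rewrite -[leRHS]mulr1 ler_pM2l ?divr_gt0// ler_pdivrMr// mul1r.
by rewrite (le_trans yL1)// lerDl.
Unshelve. all: by end_near. Qed.

Lemma expR_sub1_bounds (R : realType) (x : R) :
  x <= expR x - 1 <= x * expR x.
Proof.
rewrite lerBrDl expR_ge1Dx/=.
have := expR_ge1Dx (- x); rewrite expRN => H.
have := ler_wpM2r (expR_ge0 x) H.
by rewrite mulVf ?gt_eqF ?expR_gt0// mulrDl mul1r mulNr; lra.
Qed.

Lemma cvg_pinfty_inv (R : realType) : (y^-1 : R) @[y --> +oo] --> 0.
Proof.
apply/(@gtr0_cvgV0 _ _ _ _ (fun y : R => y)); last exact: cvg_id.
by apply: nbhs_pinfty_gt; exact: num_real.
Qed.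

Lemma log_index_exp_increment (R : realType) (Phi : R -> R) (alpha h : R) :
  log_index Phi alpha -> 0 <= h ->
  y * (expR (Phi (y + h) - Phi y) - 1) @[y --> +oo] --> alpha * h.
Proof.
move=> HPhi h0; have C1 := log_index_increment HPhi h0.
have C0 : Phi (y + h) - Phi y @[y --> +oo] --> 0.
  rewrite -[X in _ --> X](mul0r (alpha * h)).
  apply: (@cvg_trans _ (y^-1 * (y * (Phi (y + h) - Phi y)) @[y --> +oo])).
    apply: near_eq_cvg; near=> y.
    have y0 : 0 < y by near: y; apply: nbhs_pinfty_gt; exact: num_real.
    by rewrite mulrA mulVf ?mul1r// gt_eqF.
  exact: cvgM (@cvg_pinfty_inv R) C1.
have CE : expR (Phi (y + h) - Phi y) @[y --> +oo] --> (1 : R).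
  rewrite -[X in _ --> X]expR0; apply: continuous_cvg C0; exact: continuous_expR.
apply: (squeeze_cvgr _ C1); last first.
  by rewrite -[X in _ --> X]mulr1; exact: (cvgM C1 CE).
near=> y.
have y0 : 0 < y by near: y; apply: nbhs_pinfty_gt; exact: num_real.
by rewrite /= -mulrA !ler_pM2l// expR_sub1_bounds.
Unshelve. all: by end_near. Qed.

Lemma le_ln (R : realType) (b y : R) : 0 < y -> expR b <= y -> b <= ln y.
Proof. by move=> y0 by_; rewrite -ler_expR lnK. Qed.

(** From some point on [log (expR (Phi y) / y)] is at most a constant plus
    [(alpha + b - 1) log y], and [b = (1 - alpha) / 2] keeps the slope negative. *)
Lemma log_index_lt1 (R : realType) (Phi : R -> R) (alpha : R) :
  log_index Phi alpha -> alpha < 1 -> expR (Phi y) / y @[y --> +oo] --> 0.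
Proof.
move=> HPhi a1.
have b0 : 0 < (1 - alpha) / 2 by rewrite divr_gt0// subr_gt0.
have [Y Y0 HY] := HPhi _ b0; set b := (1 - alpha) / 2 in b0 HY *.
apply/cvgrPdist_le => e e0; near=> y.
have Yy : Y <= y by near: y; apply: nbhs_pinfty_ge; exact: num_real.
have y0 : 0 < y := lt_le_trans Y0 Yy.
have lnyB : (Phi Y - (alpha + b) * ln Y - ln e) / b <= ln y.
  by apply: le_ln.
have := HY Y y (lexx _) Yy; rewrite ler_norml => /andP[_ up].
rewrite sub0r normrN ger0_norm ?divr_ge0 ?expR_ge0 ?(ltW y0)//.
rewrite ler_pdivrMr// -[X in _ <= X * _](lnK e0) -[X in _ <= _ * X](lnK y0) -expRD.
rewrite ler_expR; move: lnyB; rewrite ler_pdivrMr// /b in up *; nra.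
Unshelve. all: by end_near. Qed.

(** The lower bound matching [log_index_lt1], now with a positive slope. *)
Lemma log_index_gt1 (R : realType) (Phi : R -> R) (alpha : R) :
  log_index Phi alpha -> 1 < alpha -> expR (Phi y) / y @[y --> +oo] --> +oo.
Proof.
move=> HPhi a1.
have b0 : 0 < (alpha - 1) / 2 by rewrite divr_gt0// subr_gt0.
have [Y Y0 HY] := HPhi _ b0; set b := (alpha - 1) / 2 in b0 HY *.
apply/cvgryPge => B; near=> y.
have Yy : Y <= y by near: y; apply: nbhs_pinfty_ge; exact: num_real.
have y0 : 0 < y := lt_le_trans Y0 Yy.
have lnyB : (ln (`|B| + 1) - Phi Y + (alpha - b) * ln Y) / b <= ln y.
  by apply: le_ln.
have := HY Y y (lexx _) Yy; rewrite ler_norml => /andP[lo _].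
have B1 : 0 < `|B| + 1 by rewrite ltr_wpDl.
apply: (@le_trans _ _ (`|B| + 1)); first by rewrite (le_trans (ler_norm B))// lerDl.
rewrite ler_pdivlMr// -[X in X * _ <= _](lnK B1) -[X in _ * X <= _](lnK y0) -expRD.
rewrite ler_expR; move: lnyB; rewrite ler_pdivrMr// /b in lo *; nra.
Unshelve. all: by end_near. Qed.

(** A regularly varying function of index [alpha] can be equivalent to [s y]
    with [0 < s < +oo] only if [alpha = 1]; the values [0] and [+oo] of [s] are
    fixed by the factor [alpha] anyway, as it is positive when [s = +oo]. *)
Lemma exp_log_index_limit (R : realType) (Phi : R -> R) (alpha c : R) (s : \bar R) :
  log_index Phi alpha -> 0 < c ->
  (c * (expR (Phi y) / y))%:E @[y --> +oo] --> s -> (s * alpha%:E = s)%E.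
Proof.
move=> HPhi c0 Cs; have [a1|a1|->] := ltgtP alpha 1; last by rewrite mule1.
- suff -> : s = 0%E by rewrite mul0e.
  apply: (cvg_unique _ Cs) => //; apply/fine_cvgP; split; first exact: nearW.
  by rewrite -[X in _ --> X](mulr0 c); apply: cvgMr; exact: log_index_lt1 a1.
- suff -> : s = +oo%E by rewrite gt0_mulye// lte_fin (lt_trans ltr01).
  apply: (cvg_unique _ Cs) => //; apply/cvgeryP.
  by apply: gt0_cvgMry => //; exact: log_index_gt1 a1.
Qed.

Lemma exp_log_index_increment_ge0 (R : realType) (Phi : R -> R) (alpha c : R)
    (s : \bar R) (h : R) :
  log_index Phi alpha -> 0 < c -> (0 <= s)%E ->
  (c * (expR (Phi y) / y))%:E @[y --> +oo] --> s -> 0 <= h ->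
  (c * expR (Phi (y + h)) - c * expR (Phi y))%:E @[y --> +oo] --> (s * h%:E)%E.
Proof.
move=> HPhi c0 s0 Cs; rewrite le_eqVlt => /predU1P[<-|h0].
  rewrite mule0; under eq_fun do rewrite addr0 subrr.
  exact: cvg_cst.
have sa := exp_log_index_limit HPhi c0 Cs.
have CI : (y * (expR (Phi (y + h) - Phi y) - 1))%:E @[y --> +oo] --> (alpha * h)%:E.
  apply: cvg_EFin; first exact: nearW.
  exact: log_index_exp_increment (ltW h0).
rewrite -sa -muleA -EFinM.
have sdef : (s *? (alpha * h)%:E)%E.
  (* The product of limits is defined because alpha is positive if s = +oo. *)
  case: s s0 sa {Cs} => [r| |]//= _ sa.
  have a0 : 0 < alpha.
    rewrite ltNge; apply/negP; rewrite le_eqVlt => /predU1P[a0|a0].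
      by move: sa; rewrite a0 mule0.
    by move: sa; rewrite lt0_mulye ?lte_fin.
  by rewrite /mule_def/= gt_eqF// mulr_gt0.
apply: cvg_trans (cvgeM sdef Cs CI).
  apply: near_eq_cvg; near=> y.
  have y0 : 0 < y by near: y; apply: nbhs_pinfty_gt; exact: num_real.
  rewrite /= -EFinM; congr EFin; rewrite expRB; field.
  by rewrite !gt_eqF// expR_gt0.
Unshelve. all: by end_near. Qed.

Lemma exp_log_index_increment (R : realType) (Phi : R -> R) (alpha c : R)
    (s : \bar R) (h : R) :
  log_index Phi alpha -> 0 < c -> (0 <= s)%E ->
  (c * (expR (Phi y) / y))%:E @[y --> +oo] --> s ->
  (c * expR (Phi (y + h)) - c * expR (Phi y))%:E @[y --> +oo] --> (s * h%:E)%E.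
Proof.
move=> HPhi c0 s0 Cs; have [h0|h0] := leP 0 h.
  exact: exp_log_index_increment_ge0 HPhi c0 s0 Cs h0.
(* For h < 0, the increment over [y + h, y] is one of positive length. *)
have nh0 : 0 <= - h by rewrite oppr_ge0 ltW.
have C := exp_log_index_increment_ge0 HPhi c0 s0 Cs nh0.
rewrite EFinN muleN in C.
have /cvgeN := (cvg_comp _ _ (cvg_addrr h) C).
rewrite oppeK; apply: cvg_trans; apply: near_eq_cvg; apply: nearW => y /=.
by rewrite addrK opprB.
Qed.

Lemma von_mises_increment (R : realType) (f : R -> \bar R) (s : \bar R) (h : R) :
  von_mises f -> (0 <= s)%E -> (y^-1%:E * f y)%E @[y --> +oo] --> s ->
  (fine (f (y + h)) - fine (f y))%:E @[y --> +oo] --> (s * h%:E)%E.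
Proof.
move=> [alpha [y0 [c0 [a [y00 c00 ha ia hf]]]]] s0 fs.
have HPhi := log_index_Rintegral y00 ha ia.
set Phi := (Phi in log_index Phi _) in HPhi.
have fE y : y0 <= y -> f y = (c0 * expR (Phi y))%:E by exact: hf.
have Cs : (c0 * (expR (Phi y) / y))%:E @[y --> +oo] --> s.
  apply: cvg_trans fs; apply: near_eq_cvg; near=> y.
  by rewrite fE// -EFinM mulrA mulrC.
apply: cvg_trans (exp_log_index_increment HPhi c00 s0 Cs); apply: near_eq_cvg.
near=> y; rewrite !fE//.
rewrite -lerBlDr; near: y; apply: nbhs_pinfty_ge; exact: num_real.
Unshelve. all: by end_near. Qed.

Lemma von_mises_near_pos (R : realType) (f : R -> \bar R) : von_mises f ->
  \forall y \near +oo, exists2 r, 0 < r & f y = r%:E.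
Proof.
move=> [alpha [y0 [c0 [a [y00 c00 ha ia hf]]]]]; near=> y.
rewrite hf//; eexists; last by [].
by rewrite mulr_gt0// expR_gt0.
Unshelve. all: by end_near. Qed.

(** * Large deviation bounds in the ambient space *)

Section InfOn.
Context (R : realType) (T : Type).
Implicit Types (I : T -> \bar R) (A B : set T).

Lemma inf_on_le I A x : A x -> (inf_on I A <= I x)%E.
Proof. by move=> Ax; apply: ereal_inf_lbound; exists x. Qed.

Lemma le_inf_on I A c : (forall x, A x -> (c <= I x)%E) -> (c <= inf_on I A)%E.
Proof. by move=> H; apply: le_ereal_inf_tmp => _ [x Ax <-]; exact: H. Qed.

Lemma inf_on_lt I A c : (inf_on I A < c)%E -> exists2 x, A x & (I x < c)%E.
Proof. by move=> /ereal_inf_lt[_ [x Ax <-] Ic]; exists x. Qed.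

Lemma inf_onS I A B : A `<=` B -> (inf_on I B <= inf_on I A)%E.
Proof. by move=> AB; apply: le_inf_on => x /AB; exact: inf_on_le. Qed.

End InfOn.

Section ExtendedLimits.
Context (R : realType).
Implicit Types (u : R -> \bar R) (F : set_system R).

Lemma near_limf_esup_lt u F c : Filter F -> (limf_esup u F < c)%E ->
  \forall y \near F, (u y < c)%E.
Proof.
move=> FF; rewrite limf_esupE => /ereal_inf_lt[_ [V FV <-] Vc].
apply: filterS FV => y Vy; apply: le_lt_trans Vc.
by apply: ereal_sup_ubound; exists y.
Qed.

Lemma near_limf_einf_gt u F c : Filter F -> (c < limf_einf u F)%E ->
  \forall y \near F, (c < u y)%E.
Proof.
move=> FF; rewrite -lteN2 -limf_esupN => /(near_limf_esup_lt FF).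
by apply: filterS => y; rewrite lteN2.
Qed.

Lemma cvge_between u F l : Filter F ->
  (forall c, (c < l)%E -> \forall y \near F, (c < u y)%E) ->
  (forall c, (l < c)%E -> \forall y \near F, (u y < c)%E) ->
  u y @[y --> F] --> l.
Proof.
move=> FF lo up; case: l lo up => [r| |] lo up.
- apply/fine_cvgP; split.
    have := up (r + 1)%:E ltac:(by rewrite lte_fin ltrDl).
    have := lo (r - 1)%:E ltac:(by rewrite lte_fin gtrBl).
    apply: filterS2 => y l1 u1.
    by rewrite fin_real// (lt_trans _ l1) ?ltNyr// (lt_trans u1) ?ltry.
  apply/cvgrPdist_lt => e e0.
  have := up (r + e)%:E ltac:(by rewrite lte_fin ltrDl).
  have := lo (r - e)%:E ltac:(by rewrite lte_fin gtrBl).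
  apply: filterS2 => y /=; case: (u y) => [v| |]//=; rewrite !lte_fin ltr_norml.
  move=> l1 u1; apply/andP; split; lra.
- by apply/cvgeyPgt => A; apply: lo; rewrite ltry.
- by apply/cvgeNyPlt => A; apply: up; rewrite ltNyr.
Qed.

End ExtendedLimits.

Section Borel.
Context (R : realType) (m : nat).
Local Notation E := 'rV[R]_m.

Lemma borel_open (A : set E) : open A -> borel A.
Proof. by move=> oA; exact: sub_sigma_algebra. Qed.

Lemma borelE (A : set E) :
  borel A = measurable (A : set (g_sigma_algebraType (@open E))).
Proof. by []. Qed.

Lemma borelI (A B : set E) : borel A -> borel B -> borel (A `&` B).
Proof. by rewrite !borelE; exact: measurableI. Qed.

Lemma borel_closed (A : set E) : closed A -> borel A.
Proof.
move=> cA; rewrite borelE -(setCK A); apply: measurableC.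
by apply: borel_open; exact: closed_openC.
Qed.

Lemma closed_coord_ge (j : 'I_m) (c : R) : closed [set x : E | c <= x 0 j].
Proof.
apply: (@closed_comp _ _ (fun x : E => x 0 j) [set t | c <= t]).
  by move=> x _; exact: coord_continuous.
exact: closed_ge.
Qed.

Lemma open_coord_gt (j : 'I_m) (c : R) : open [set x : E | c < x 0 j].
Proof.
apply: (@open_comp _ _ (fun x : E => x 0 j) [set t | c < t]).
  by move=> x _; exact: coord_continuous.
exact: open_gt.
Qed.

Lemma closed_forall (T : topologicalType) (J : Type) (A : J -> set T) :
  (forall j, closed (A j)) -> closed [set x | forall j, A j x].
Proof.
move=> cA; rewrite (_ : [set x | _] = \bigcap_j A j); first exact: closed_bigI.
by apply/seteqP; split => x /=; [move=> H j _; exact: H|move=> H j; exact: H].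
Qed.

Lemma closed_orthant : closed (orthant R m).
Proof. by apply: closed_forall => j; exact: closed_coord_ge. Qed.

End Borel.

(** The vector stays in the orthant and [I] is infinite outside, so the LDP,
    which speaks of the relative topology of the orthant, yields bounds with the
    interior and closure of the whole space. They are stated as eventual strict
    inequalities, the form in which they are combined below. *)
Section LDPBounds.
Context (d : measure_display) (T : measurableType d) (R : realType).
Context (P : probability T R) (m : nat).
Variables (Y : T -> 'rV[R]_m) (I : 'rV[R]_m -> \bar R).
Hypothesis Y_ge0 : forall w, orthant R m (Y w).
Hypothesis I_out : forall x, ~ orthant R m x -> I x = +oo%E.
Hypothesis Y_LDP : LDP P Y I.

Let logP A y := (y^-1%:E * lne (P [set w | A (y^-1 *: Y w)]))%E.

Lemma logP_orthant A : \forall y \near +oo, logP (A `&` orthant R m) y = logP A y.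
Proof.
near=> y; congr (_ * lne (P _))%E; apply/seteqP; split => w /=; first by case.
move=> Aw; split=> // j; rewrite mxE mulr_ge0//; last exact: Y_ge0.
by rewrite invr_ge0.
Unshelve. all: by end_near. Qed.

Lemma LDP_lower A c : borel A -> (inf_on I (interior A) < c)%E ->
  \forall y \near +oo, (- c < logP A y)%E.
Proof.
move=> bA Ac; have AO : A `&` orthant R m `<=` orthant R m by move=> ? [].
have [lo _ _] := Y_LDP (borelI bA (borel_closed (@closed_orthant R m))) AO.
have : (- c < limf_einf (logP (A `&` orthant R m)) (pinfty_nbhs R))%E.
  apply: lt_le_trans lo; rewrite lteN2; apply: le_lt_trans Ac.
  apply: le_inf_on => x Ax; have [Ox|/I_out ->] := pselect (orthant R m x); last exact: leey.
  (* A relative neighbourhood in the orthant is a trace of an ordinary one. *)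
  apply: inf_on_le; rewrite /interior.
  change (nbhs_subspace (x : subspace (orthant R m)) (A `&` orthant R m)).
  rewrite -(nbhs_subspace_in Ox); apply: filterS Ax.
  by move=> z /= Az Oz; split.
move=> /near_limf_einf_gt H; have := logP_orthant A.
by apply: filterS2 H => y + <-.
Qed.

Lemma LDP_upper A c : borel A -> (c < inf_on I (closure A))%E ->
  \forall y \near +oo, (logP A y < - c)%E.
Proof.
move=> bA Ac; have AO : A `&` orthant R m `<=` orthant R m by move=> ? [].
have [_ _ up] := Y_LDP (borelI bA (borel_closed (@closed_orthant R m))) AO.
have : (limf_esup (logP (A `&` orthant R m)) (pinfty_nbhs R) < - c)%E.
  apply: le_lt_trans up _; rewrite lteN2; apply: lt_le_trans Ac _.
  apply: inf_onS => x Cx B Bx.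
  have /Cx[z [[Az _] Bz]] : nbhs (x : subspace (orthant R m)) B.
    exact: incl_subspace_continuous.
  by exists z.
move=> /near_limf_esup_lt H; have := logP_orthant A.
by apply: filterS2 H => y + <-.
Qed.

End LDPBounds.

(** * From the LDP to the tail limit *)

(** [expeR] is an order isomorphism onto [[0, +oo]], so it preserves the
    order-theoretic description of convergence. *)
Lemma cvg_expeR (R : realType) (F : set_system R) (u : R -> \bar R) (l : \bar R) :
  Filter F -> u y @[y --> F] --> l -> expeR (u y) @[y --> F] --> expeR l.
Proof.
move=> FF ul; apply: cvge_between => c.
- have [c0|c0] := ltP c 0%E.
    by move=> _; apply: nearW => y; rewrite (lt_le_trans c0)// expeR_ge0.
  have [b <-] := expeR_total c0; rewrite lte_expeR => bl.
  have /ul : nbhs l [set x | (b < x)%E].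
    by apply: open_nbhs_nbhs; split=> //; exact: open_ereal_gt_ereal.
  move=> Fu; have {}Fu : \forall y \near F, (b < u y)%E := Fu.
  by apply: filterS Fu => y; rewrite lte_expeR.
- move=> lc; have c0 : (0 <= c)%E by rewrite (le_trans (expeR_ge0 l))// ltW.
  move: lc; have [b <-] := expeR_total c0; rewrite lte_expeR => lb.
  have /ul : nbhs l [set x | (x < b)%E].
    by apply: open_nbhs_nbhs; split=> //; exact: open_ereal_lt_ereal.
  move=> Fu; have {}Fu : \forall y \near F, (u y < b)%E := Fu.
  by apply: filterS Fu => y; rewrite lte_expeR.
Qed.

Lemma cvg_ln_pinfty (R : realType) : (ln t : R) @[t --> +oo] --> +oo.
Proof.
apply/cvgryPge => B; near=> t.
by apply: le_ln.
Unshelve. all: by end_near. Qed.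

Lemma scale_setE (R : realType) (m : nat) (y : R) (A : set 'rV[R]_m) :
  0 < y -> scale_set y A = [set x | A (y^-1 *: x)].
Proof.
move=> y0; apply/seteqP; split => [_ [x Ax <-] /=|x /= Ax].
  by rewrite scalerA mulVf ?gt_eqF// scale1r.
by exists (y^-1 *: x) => //; rewrite scalerA mulfV ?gt_eqF// scale1r.
Qed.

Lemma continuity_set_inf (R : realType) (T : topologicalType) (I : T -> \bar R)
    (A : set T) : continuity_set I A ->
  inf_on I (interior A) = inf_on I A /\ inf_on I (closure A) = inf_on I A.
Proof.
move=> IA; have H1 := inf_onS I (@interior_subset _ A).
have H2 := inf_onS I (@subset_closure _ A).
by split; apply/le_anti; rewrite ?H1 ?H2/= ?andbT -?IA// IA.
Qed.

Section TailLimit.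
Context (d : measure_display) (T : measurableType d) (R : realType).
Context (P : probability T R) (m : nat).
Variables (Y : T -> 'rV[R]_m) (I : 'rV[R]_m -> \bar R).

Lemma LDP_continuity_set (A : set 'rV[R]_m) :
  (forall w, orthant R m (Y w)) -> (forall x, ~ orthant R m x -> I x = +oo%E) ->
  LDP P Y I -> borel A -> continuity_set I A ->
  (y^-1%:E * lne (P [set w | A (y^-1 *: Y w)]))%E @[y --> +oo] -->
    (- inf_on I A)%E.
Proof.
move=> Y0 Iout HL bA /continuity_set_inf[IAo IAc].
apply: cvge_between => c cI.
- rewrite -(oppeK c); apply: (LDP_lower Y0 Iout HL bA).
  by rewrite IAo lteNr.
- rewrite -(oppeK c); apply: (LDP_upper Y0 HL bA).
  by rewrite IAc lteNl.
Qed.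

(** The substitution [y = log t], [h = log lambda] in [von_mises_increment]. *)
Lemma tail_limit_von_mises (A : set 'rV[R]_m) :
  (forall x, (0 <= I x)%E) ->
  (y^-1%:E * lne (P [set w | A (y^-1 *: Y w)]))%E @[y --> +oo] -->
    (- inf_on I A)%E ->
  von_mises (fun y => (- lne (P [set w | A (y^-1 *: Y w)]))%E) ->
  tail_limit P Y I A.
Proof.
move=> I0 CA vm lambda l0; set f := (fun y => - lne _)%E in vm.
have fs : (y^-1%:E * f y)%E @[y --> +oo] --> inf_on I A.
  rewrite -(oppeK (inf_on I A)); under eq_fun do rewrite muleN.
  exact: cvgeN.
have s0 : (0 <= inf_on I A)%E by exact: le_inf_on.
have C := von_mises_increment (h := ln lambda) vm s0 fs.
have {}C := cvg_comp _ _ (@cvg_ln_pinfty R) C.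
have {}C : expeR (- (fine (f (ln t + ln lambda)) - fine (f (ln t)))%:E)
    @[t --> +oo] --> expeR (- (inf_on I A * (ln lambda)%:E))%E.
  exact: cvg_expeR _ (cvgeN C).
rewrite /epow mulNe; apply: cvg_trans C; apply: near_eq_cvg.
have PE y r : f y = r%:E -> P [set w | A (y^-1 *: Y w)] = (expR (- r))%:E.
  rewrite /f; set p := P _ => /eqP; rewrite eqe_oppLR -EFinN => /eqP fr.
  have <- : expeR (lne p) = p by rewrite lneK// in_itv/= leey andbT measure_ge0.
  by rewrite fr.
have pos := von_mises_near_pos vm.
have pos1 : \forall t \near +oo, exists2 r, 0 < r & f (ln t) = r%:E.
  exact: (@cvg_ln_pinfty R _ pos).
have pos2 : \forall t \near +oo, exists2 r, 0 < r & f (ln t + ln lambda) = r%:E.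
  exact: (@cvg_ln_pinfty R _ (@cvg_addrr R (ln lambda) _ pos)).
near=> t.
have t1 : 1 < t by [].
have t0 : 0 < t by rewrite (lt_trans ltr01).
have tl1 : 1 < t * lambda.
  rewrite -ltr_pdivrMr// div1r; near: t.
  by apply: nbhs_pinfty_gt; exact: num_real.
rewrite !scale_setE ?ln_gt0//= lnM//.
have [r _ fr] : exists2 r, 0 < r & f (ln t) = r%:E by near: t.
have [r' _ fr'] : exists2 r, 0 < r & f (ln t + ln lambda) = r%:E by near: t.
rewrite fr fr' /=.
have -> : P (Y @^-1` [set x | A ((ln t + ln lambda)^-1 *: x)]) = (expR (- r'))%:E.
  exact: PE.
have -> : P (Y @^-1` [set x | A ((ln t)^-1 *: x)]) = (expR (- r))%:E by exact: PE.
by rewrite /= -expRB; congr (expR _)%:E; ring.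
Unshelve. all: by end_near. Qed.

End TailLimit.

(** * Homogeneity of the rate function *)

Lemma lte_fin_between (R : realType) (r : R) (z : \bar R) : (r%:E < z)%E ->
  exists2 c, r < c & (c%:E < z)%E.
Proof.
case: z => [v| |]//.
- by rewrite lte_fin => rv; exists ((r + v) / 2); rewrite ?lte_fin; lra.
- by move=> _; exists (r + 1); rewrite ?ltry// ltrDl.
Qed.

Lemma near_pinfty_scale (R : realType) (k : R) (Q : R -> Prop) : 0 < k ->
  (\forall y \near +oo, Q y) -> \forall y \near +oo, Q (y * k).
Proof.
move=> k0 [M [_ MQ]]; near=> y; apply: MQ.
rewrite -ltr_pdivrMr//; near: y; apply: nbhs_pinfty_gt; exact: num_real.
Unshelve. all: by end_near. Qed.

Lemma nbhs_scale (R : realType) (m : nat) (k : R) (x : 'rV[R]_m) (A : set 'rV[R]_m) :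
  nbhs (k *: x) A -> nbhs x [set z | A (k *: z)].
Proof. exact: scaler_continuous. Qed.

Section Homogeneity.
Context (d : measure_display) (T : measurableType d) (R : realType).
Context (P : probability T R) (m : nat).
Variables (Y : T -> 'rV[R]_m) (I : 'rV[R]_m -> \bar R).
Hypothesis Y_ge0 : forall w, orthant R m (Y w).
Hypothesis I_out : forall x, ~ orthant R m x -> I x = +oo%E.
Hypothesis I_rate : rate_function I.
Hypothesis Y_LDP : LDP P Y I.

(** If [I (lambda x)] were smaller than [lambda I x], a closed neighbourhood [B]
    of [x] on which [I] exceeds some [c > I (lambda x) / lambda] would have
    probabilities decaying too fast for the lower bound on [lambda B], because
    [Y/y \in lambda B] iff [Y/(lambda y) \in B]. *)
Lemma LDP_rate_scale_ge (lambda : R) (x : 'rV[R]_m) : 0 < lambda ->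
  (lambda%:E * I x <= I (lambda *: x)%R)%E.
Proof.
move=> l0; have [I0 Ilsc] := I_rate; rewrite leNgt; apply/negP.
case E : (I (lambda *: x)) (I0 (lambda *: x)) => [v| |]// _ vI;
  last by move: vI; rewrite ltNge leey.
have : ((v / lambda)%:E < I x)%E by rewrite EFinM lte_pdivrMr// muleC.
move=> /lte_fin_between[c1 vc1 /lte_fin_between[c c1c cI]].
have [V Vx VI] := Ilsc _ _ cI.
(* The upper bound involves closures: the neighbourhood must be closed. *)
have [B Bx BV] := uniform_regular Vx.
pose B1 := [set z : 'rV[R]_m | closure B (lambda^-1 *: z)].
have cB1 : closed B1.
  apply: (@closed_comp _ _ (fun z : 'rV[R]_m => lambda^-1 *: z)).
    by move=> z _; exact: scaler_continuous.
  exact: closed_closure.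
have up : \forall y \near +oo,
    (y^-1%:E * lne (P [set w | closure B (y^-1 *: Y w)]) < - c1%:E)%E.
  apply: (LDP_upper Y_ge0 Y_LDP); first by apply: borel_closed; exact: closed_closure.
  rewrite -(closure_id _).1; last exact: closed_closure.
  apply: (@lt_le_trans _ _ c%:E); first by rewrite lte_fin.
  by apply: le_inf_on => z /BV/VI/ltW.
have lo : \forall y \near +oo,
    (- (lambda * c1)%:E < y^-1%:E * lne (P [set w | B1 (y^-1 *: Y w)]))%E.
  apply: (LDP_lower Y_ge0 I_out Y_LDP); first exact: borel_closed.
  apply: (@le_lt_trans _ _ v%:E); last by rewrite lte_fin -ltr_pdivrMl// mulrC.
  rewrite -E; apply: inf_on_le.
  have : nbhs (lambda^-1 *: (lambda *: x)) (closure B).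
    rewrite scalerA mulVf ?gt_eqF// scale1r.
    by apply: filterS Bx; exact: subset_closure.
  by move=> /nbhs_scale.
have [y [y0 ylo yup]] : exists y, [/\ 0 < y,
    (- (lambda * c1)%:E < y^-1%:E * lne (P [set w | B1 (y^-1 *: Y w)]))%E &
    ((y * lambda)^-1%:E * lne (P [set w | closure B ((y * lambda)^-1 *: Y w)])
      < - c1%:E)%E].
  have : \forall y \near +oo, 0 < y :> R by apply: nbhs_pinfty_gt; exact: num_real.
  move=> p0; have up' : \forall y \near +oo, ((y * lambda)^-1%:E *
      lne (P [set w | closure B ((y * lambda)^-1 *: Y w)]) < - c1%:E)%E.
    exact: (near_pinfty_scale (Q := fun y => (y^-1%:E *
      lne (P [set w | closure B (y^-1 *: Y w)]) < - c1%:E)%E)).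
  have [y [[y0 ylo] yup]] := filter_ex (filterI (filterI p0 lo) up').
  by exists y.
move: ylo; have -> : [set w | B1 (y^-1 *: Y w)] =
    [set w | closure B ((y * lambda)^-1 *: Y w)].
  by apply/seteqP; split=> w; rewrite /B1/= scalerA invfM mulrC.
have -> : y^-1 = lambda * (y * lambda)^-1 by field; rewrite !gt_eqF.
rewrite (EFinM lambda c1) (EFinM lambda (y * lambda)^-1) -muleA -muleN.
rewrite lte_pmul2l// => /lt_trans/(_ yup).
by rewrite ltxx.
Qed.

Lemma LDP_rate_homogeneous (lambda : R) (x : 'rV[R]_m) : 0 < lambda ->
  I (lambda *: x) = (lambda%:E * I x)%E.
Proof.
move=> l0; apply/le_anti; rewrite LDP_rate_scale_ge// andbT.
have li : 0 < lambda^-1 by rewrite invr_gt0.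
have := LDP_rate_scale_ge (lambda *: x) li.
by rewrite scalerA mulVf ?gt_eqF// scale1r muleC lee_pdivrMr// muleC.
Qed.

End Homogeneity.

(** * The exponential law of the margins *)

Section Marginals.
Context (d : measure_display) (T : measurableType d) (R : realType).
Context (P : probability T R).

Lemma measurable_superlevel (f : T -> R) (v : R) :
  measurable_fun [set: T] f -> measurable [set w | v < f w].
Proof.
move=> /(_ measurableT _ (measurable_itv `]v, +oo[)); rewrite setTI.
by congr measurable; apply/seteqP; split=> w /=; rewrite in_itv/= andbT.
Qed.

Lemma measurable_superlevel_ge (f : T -> R) (v : R) :
  measurable_fun [set: T] f -> measurable [set w | v <= f w].
Proof.
move=> /(_ measurableT _ (measurable_itv `[v, +oo[)); rewrite setTI.
by congr measurable; apply/seteqP; split=> w /=; rewrite in_itv/= andbT.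
Qed.

Section OneVariable.
Variable X : {RV P >-> R}.
Hypothesis X_continuous : continuous (cdf X).

Let F x := fine (cdf X x).

Let FE x : cdf X x = (F x)%:E.
Proof. by rewrite /F fineK// fin_num_measure. Qed.

Let F_le x y : x <= y -> F x <= F y.
Proof. by move=> xy; rewrite -lee_fin -!FE; exact: cdf_nondecreasing. Qed.

Let F_continuous : continuous F.
Proof.
move=> x; have XC : cdf X y @[y --> x] --> (F x)%:E.
  by rewrite -FE; exact: X_continuous.
exact: fine_cvg XC.
Qed.

Let mF : measurable_fun [set: T] (F \o X).
Proof.
by apply: measurableT_comp => //; exact: nondecreasing_measurable.
Qed.

Let cdf_hits u : 0 < u < 1 -> exists x, F x = u.
Proof.
move=> /andP[u0 u1].
have Fy : F x @[x --> +oo] --> (1 : R) by exact: fine_cvg (@cvg_cdfy1 _ _ _ _ X).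
have FNy : F x @[x --> -oo] --> (0 : R) by exact: fine_cvg (@cvg_cdfNy0 _ _ _ _ X).
have [b ub] : exists b, u < F b.
  have := filter_ex (cvgr_gt _ Fy _ u1); by move=> [b]; exists b.
have [a au] : exists a, F a < u.
  have := filter_ex (cvgr_lt _ FNy _ u0); by move=> [a]; exists a.
have ab : a <= b.
  by rewrite leNgt; apply/negP => /ltW/F_le; rewrite leNgt (lt_trans au).
have [||x _ xu] := @IVT _ F a b u ab.
- exact: continuous_subspaceT.
- by rewrite ge_min le_max (ltW au) (ltW ub) orbT.
by exists x.
Qed.

Let P_gt x : P [set w | x < X w] = (1 - F x)%:E.
Proof.
have := cdf_ccdf_1 X x; rewrite FE => H.
have -> : P [set w | x < X w] = ccdf X x.
  by rewrite /ccdf /distribution /pushforward; congr (P _); apply/seteqP; split=> w /=;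
    rewrite in_itv/= andbT.
have fc : ccdf X x \is a fin_num by exact: fin_num_measure.
move: H; rewrite -(fineK fc) -EFinD => -[H]; congr EFin.
by rewrite -H; ring.
Qed.

(** The probability integral transform. [F] may be constant on intervals, so
    [u < F X] is only enclosed: it implies [x < X] when [F x = u], and follows
    from [x < X] when [F x = u + e]. *)
Lemma probability_cdf_gt u : 0 < u < 1 ->
  P [set w | u < fine (cdf X (X w))] = (1 - u)%:E.
Proof.
move=> u01; have m1 v : measurable [set w | v < F (X w)] by exact: measurable_superlevel.
have m2 v : measurable [set w | v < X w].
  by apply: measurable_superlevel; exact: measurable_funPT.
apply/le_anti/andP; split.
  have [x <-] := cdf_hits u01; rewrite -P_gt.
  apply: le_measure; rewrite ?inE// => w /=.
  by apply: contraTT; rewrite -!leNgt; exact: F_le.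
apply/lee_addgt0Pr => e e0.
have [e1|e1] := leP 1 (u + e).
  rewrite (@le_trans _ _ e%:E)// ?lee_fin; first by lra.
  by rewrite leeDr// measure_ge0.
have [x xu] : exists x, F x = u + e.
  by apply: cdf_hits; rewrite e1 andbT addr_gt0//; case/andP: u01.
rewrite -leeBlDr// -EFinB (_ : 1 - u - e = 1 - F x); last by rewrite xu; ring.
rewrite -P_gt; apply: le_measure; rewrite ?inE// => w /= /ltW/F_le.
by apply: lt_le_trans; rewrite xu ltrDl.
Qed.

Lemma probability_cdf_ge1 : P [set w | 1 <= fine (cdf X (X w))] = 0%E.
Proof.
have m1 v : measurable [set w | v < F (X w)] by exact: measurable_superlevel.
have m2 : measurable [set w | 1 <= F (X w)] by exact: measurable_superlevel_ge.
apply/le_anti; rewrite measure_ge0 andbT.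
apply/lee_addgt0Pr => e e0; rewrite add0e.
pose v := Num.max (1 / 2) (1 - e).
have v01 : 0 < v < 1 by rewrite /v lt_max gt_max; apply/andP; split; lra.
apply: (@le_trans _ _ (1 - v)%:E); last first.
  rewrite lee_fin; have : 1 - e <= v by rewrite le_max lexx orbT.
  lra.
rewrite -(probability_cdf_gt v01); apply: le_measure; rewrite ?inE// => w /=.
by apply: lt_le_trans; case/andP: v01.
Qed.

(** [- log (1 - U)] is exponential for a uniform [U]. The event [F X = 1], where
    the convention [ln 0 = 0] spoils the equivalence of [s < - log (1 - F X)]
    with [1 - exp (- s) < F X], is null. *)
Lemma probability_neg_ln_survival_gt s : 0 < s ->
  P [set w | s < - ln (1 - fine (cdf X (X w)))] = (expR (- s))%:E.
Proof.
move=> s0; pose u := 1 - expR (- s).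
have es : 0 < expR (- s) < 1.
  by rewrite expR_gt0 -[ltRHS]expR0 ltr_expR oppr_lt0.
have u01 : 0 < u < 1 by rewrite /u; case/andP: es => ? ?; apply/andP; split; lra.
have m1 v : measurable [set w | v < F (X w)] by exact: measurable_superlevel.
have m2 : measurable [set w | 1 <= F (X w)] by exact: measurable_superlevel_ge.
have -> : [set w | s < - ln (1 - fine (cdf X (X w)))] =
    [set w | u < F (X w)] `\` [set w | 1 <= F (X w)].
  apply/seteqP; split => w /=; rewrite -/(F (X w)).
    have [F1|F1] := ltP (F (X w)) 1; last first.
      by rewrite ln0 ?oppr0 ?subr_le0// ltNge (ltW s0).
    rewrite ltrNr => H; split; last by [].
    suff : 1 - F (X w) < expR (- s) by rewrite /u; lra.
    by rewrite -[X in X < _]lnK ?posrE ?subr_gt0// ltr_expR.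
  move=> [uF /negP]; rewrite -ltNge => F1.
  rewrite ltrNr -ltr_expR lnK ?posrE ?subr_gt0//.
  by move: uF; rewrite /u; lra.
rewrite measureD//; last by rewrite -ge0_fin_numE ?fin_num_measure.
rewrite [X in (X - _)%E](_ : _ = (1 - u)%:E); last exact: probability_cdf_gt.
rewrite [X in (_ - X)%E](_ : _ = 0%E).
  by rewrite sube0 /u; congr EFin; ring.
by apply: (subset_measure0 _ m2 (@subIsetr _ _ _)) probability_cdf_ge1; exact: measurableI.
Qed.

Lemma measurable_neg_ln_survival :
  measurable_fun [set: T] (fun w => - ln (1 - fine (cdf X (X w)))).
Proof.
apply: measurableT_comp => //; apply: measurableT_comp => //.
exact: measurable_funB.
Qed.

End OneVariable.
End Marginals.

(** * The rate function of Y *)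

Section RateOfY.
Context (d : measure_display) (T : measurableType d) (R : realType).
Context (P : probability T R) (m : nat) (X : 'I_m -> {RV P >-> R}).

Lemma YvecE w j : Yvec X w 0 j = - ln (1 - fine (cdf (X j) (X j w))).
Proof. by rewrite mxE. Qed.

Lemma survival_itv j w : 0 <= survival X j w <= 1.
Proof.
rewrite /survival subr_ge0 gerBl fine_ge0 ?cdf_ge0// andbT -lee_fin.
by rewrite fineK ?fin_num_measure// cdf_le1.
Qed.

Lemma Yvec_orthant w : orthant R m (Yvec X w).
Proof.
move=> j; rewrite mxE oppr_ge0; apply: ln_le0.
by case/andP: (survival_itv j w).
Qed.

Lemma measurable_Yvec j : measurable_fun [set: T] (fun w => Yvec X w 0 j).
Proof.
by under eq_fun do rewrite YvecE; exact: measurable_neg_ln_survival.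
Qed.

Hypothesis X_continuous : forall j : 'I_m, continuous (cdf (X j)).

Lemma logP_Yvec_gt (j : 'I_m) (mu y : R) : 0 < mu -> 0 < y ->
  (y^-1%:E * lne (P [set w | (mu < (y^-1 *: Yvec X w) 0 j)%R]))%E = (- mu)%:E.
Proof.
move=> mu0 y0.
have -> : [set w | mu < (y^-1 *: Yvec X w) 0 j] =
    [set w | mu * y < - ln (1 - fine (cdf (X j) (X j w)))].
  by apply/seteqP; split=> w /=; rewrite mxE YvecE -ltr_pdivlMr// mulrC.
rewrite probability_neg_ln_survival_gt// ?mulr_gt0//.
rewrite lne_EFin ?expR_gt0// expRK -EFinM; congr EFin.
by field; rewrite gt_eqF.
Qed.

Variable I : 'rV[R]_m -> \bar R.
Hypothesis I_rate : rate_function I.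
Hypothesis I_neg : forall x : 'rV[R]_m, (exists j : 'I_m, x 0 j < 0) -> I x = +oo%E.
Hypothesis Y_LDP : LDP P (Yvec X) I.

Lemma rate_out_orthant x : ~ orthant R m x -> I x = +oo%E.
Proof.
move=> /existsNP[j /negP]; rewrite -ltNge => xj.
by apply: I_neg; exists j.
Qed.

(** The open half-space at level [lambda] has decay rate exactly [lambda]. The
    LDP lower bound on it gives [lambda <= inf]; the upper bound is for closed
    sets, and is used on the half-spaces at levels [mu > lambda]. *)
Lemma rate_inf_halfspace (lambda : R) (j : 'I_m) : 0 <= lambda ->
  inf_on I [set x : 'rV[R]_m | lambda < x 0 j] = lambda%:E.
Proof.
move=> l0; apply/le_anti/andP; split; rewrite leNgt; apply/negP.
- (* mu is positive even if lambda = 0, as the exponential law requires. *)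
  move=> /lte_fin_between[mu lmu muI].
  have mu0 : 0 < mu := le_lt_trans l0 lmu.
  have cB := @closed_coord_ge R m j mu.
  have up : \forall y \near +oo, (y^-1%:E *
      lne (P [set w | (mu <= (y^-1 *: Yvec X w) 0 j)%R]) < - mu%:E)%E.
    apply: (LDP_upper Yvec_orthant Y_LDP (borel_closed cB)).
    rewrite -(closure_id _).1//; apply: (lt_le_trans muI); apply: inf_onS => x /=.
    exact: lt_le_trans.
  have p0 : \forall y \near +oo, 0 < y :> R.
    by apply: nbhs_pinfty_gt; exact: num_real.
  have [y [yup y0]] := filter_ex (filterI up p0).
  move: yup; rewrite ltNge => /negP; apply; rewrite -EFinN -(logP_Yvec_gt j mu0 y0).
  have mY : measurable_fun [set: T] (fun w => (y^-1 *: Yvec X w) 0 j).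
    under eq_fun do rewrite mxE.
    by apply: measurable_funM => //; exact: measurable_Yvec.
  rewrite lee_pmul2l ?lte_fin ?invr_gt0// lee_lne ?in_itv/= ?leey ?andbT//.
  apply: le_measure; rewrite ?inE.
  + exact: measurable_superlevel.
  + exact: measurable_superlevel_ge.
  + by move=> w /ltW.
- move: l0; rewrite le_eqVlt => /predU1P[<-|l0].
    by apply/negP; rewrite -leNgt; apply: le_inf_on => x _; exact: I_rate.1.
  move=> infl.
  have : exists2 c, (inf_on I [set x : 'rV[R]_m | (lambda < x 0 j)%R] < c%:E)%E & c < lambda.
    case: (inf_on _ _) infl => [v| |]//.
    - by rewrite lte_fin => vl; exists ((v + lambda) / 2); rewrite ?lte_fin; lra.
    - by move=> _; exists (lambda - 1); [exact: ltNyr|rewrite gtrBl; exact: ltr01].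
  move=> [c infc cl].
  have oB := @open_coord_gt R m j lambda.
  have lo : \forall y \near +oo, (- c%:E < y^-1%:E *
      lne (P [set w | (lambda < (y^-1 *: Yvec X w) 0 j)%R]))%E.
    apply: (LDP_lower Yvec_orthant rate_out_orthant Y_LDP (borel_open oB)).
    by rewrite ((interior_id _).1 oB).
  have p0 : \forall y \near +oo, 0 < y :> R.
    by apply: nbhs_pinfty_gt; exact: num_real.
  have [y [ylo y0]] := filter_ex (filterI lo p0).
  by move: ylo; rewrite logP_Yvec_gt// lte_fin ltrN2 ltNge (ltW cl).
Qed.

Lemma rate_homogeneous (lambda : R) (x : 'rV[R]_m) : 0 < lambda ->
  I (lambda *: x) = (lambda%:E * I x)%E.
Proof.
exact: (LDP_rate_homogeneous Yvec_orthant rate_out_orthant I_rate Y_LDP).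
Qed.

(** Homogeneity makes [I] small near [0] along the ray of a point where it is
    finite, and lower semicontinuity passes to [0]. *)
Lemma rate0 : (0 < m)%N -> I 0 = 0%E.
Proof.
move=> m0; have [I0 Ilsc] := I_rate; apply/le_anti; rewrite I0 andbT leNgt.
apply/negP => /lte_fin_between[c c0 /Ilsc[V V0 VI]].
have [x _ xI] : exists2 x : 'rV[R]_m, 0 < x 0 (Ordinal m0) & (I x < 1%:E)%E.
  apply: inf_on_lt; rewrite rate_inf_halfspace// lte_fin; exact: ltr01.
case E : (I x) xI (I0 x) => [v| |]//; rewrite lte_fin lee_fin => v1 v0.
have : \forall k \near 0^'+, V (k *: x).
  have kx : k *: x @[k --> 0^'+] --> (0 : 'rV[R]_m).
    rewrite -[X in _ --> X](scale0r x); apply: cvgZr_tmp.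
    by apply: cvg_at_right_filter; exact: cvg_id.
  exact: kx.
move=> Vk; have kc : \forall k \near 0^'+, k < c by exact: nbhs_right_lt.
have k0 : \forall k \near 0^'+, 0 < k :> R by exact: nbhs_right_gt.
have [k [[/VI cI kc1] k1]] := filter_ex (filterI (filterI Vk kc) k0).
move: cI; rewrite rate_homogeneous// E -EFinM lte_fin ltNge => /negP; apply.
by rewrite (le_trans _ (ltW kc1))// ler_piMr// ltW.
Qed.



End RateOfY.

(** * Orthants with vertex a *)

Section OrthantAbove.
Context (R : realType) (m : nat).
Implicit Types (a : 'rV[R]_m).

Lemma open_orthant_above_open a : open (open_orthant_above a).
Proof.
rewrite openE => x xa; exists (fun _ j => [set t | a 0 j < t]).
  by move=> i j; rewrite ord1; apply: open_nbhs_nbhs; split; [exact: open_gt|exact: xa].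
by move=> z za j; exact: za.
Qed.

(** A point [x] of the closure has [a_j <= x_j], so every dilation [k x] with
    [k > 1] is in the open set, at the cost of a factor [k] in [I]. Positivity of
    every [a_j] is essential: dilation does not move a vanishing coordinate. *)
Lemma continuity_set_orthant_above (I : 'rV[R]_m -> \bar R) a :
  (forall x, (0 <= I x)%E) ->
  (forall (lambda : R) x, 0 < lambda -> I (lambda *: x) = (lambda%:E * I x)%E) ->
  (forall j, 0 < a 0 j) -> continuity_set I (open_orthant_above a).
Proof.
move=> I0 Ihom a0; rewrite /continuity_set.
rewrite ((interior_id _).1 (@open_orthant_above_open a)).
apply/le_anti/andP; split; last exact: inf_onS (@subset_closure _ _).
have cl : closure (open_orthant_above a) `<=` [set x | forall j, a 0 j <= x 0 j].
  have cB : closed [set x : 'rV[R]_m | forall j, a 0 j <= x 0 j].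
    by apply: closed_forall => j; exact: closed_coord_ge.
  rewrite [X in _ `<=` X]((closure_id _).1 cB).
  by apply: closure_subset => x xa j; exact/ltW/xa.
apply: le_inf_on => x /cl xa.
case E : (I x) (I0 x) => [v| |]//; last by move=> _; exact: leey.
rewrite lee_fin => v0; rewrite leNgt; apply/negP => /lte_fin_between[c vc cI].
have v1 : 0 < v + 1 by rewrite ltr_wpDl.
(* This k makes k v = v + (c - v) v / (v + 1) at most c. *)
pose k := 1 + (c - v) / (v + 1).
have k1 : 1 < k by rewrite /k ltrDl divr_gt0// subr_gt0.
have k0 : 0 < k := lt_trans ltr01 k1.
have kx : open_orthant_above a (k *: x).
  move=> j; rewrite mxE; apply: (le_lt_trans (xa j)).
  by rewrite ltr_pMl// (lt_le_trans (a0 j)).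
have := lt_le_trans cI (inf_on_le I kx).
rewrite Ihom// E -EFinM lte_fin ltNge => /negP; apply.
rewrite /k mulrDl mul1r -lerBrDl mulrAC ler_pdivrMr// ler_pM2l ?subr_gt0//.
by rewrite lerDl.
Qed.

End OrthantAbove.

Lemma eq_von_mises (R : realType) (f g : R -> \bar R) :
  (forall y, 0 < y -> f y = g y) -> von_mises f -> von_mises g.
Proof.
move=> fg [alpha [y0 [c0 [a [y00 c00 ha ia hf]]]]].
exists alpha, y0, c0, a; split=> // y y0y.
by rewrite -fg ?hf// (lt_le_trans y00).
Qed.

(** [V_j > t^b] iff [Y_j > b log t]; the two sides agree at [s = 0] as well,
    where the conventions give [V_j = Y_j = 0]. *)
Lemma powR_lt_inv (R : realType) (t b s : R) : 1 < t -> 0 <= b -> 0 <= s ->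
  (t `^ b < s^-1) = (b < (ln t)^-1 * - ln s).
Proof.
move=> t1 b0; have t0 : 0 < t := lt_trans ltr01 t1; have lt0 := ln_gt0 t1.
rewrite le_eqVlt => /predU1P[<-|s0].
  rewrite invr0 (ln0 (lexx (0 : R))) oppr0 mulr0 !ltNge b0.
  by rewrite powR_ge0.
rewrite mulrC ltr_pdivlMr// -[X in _ < X^-1](lnK s0) -expRN.
by rewrite /powR gt_eqF// ltr_expR.
Qed.

Section OrthantProbabilities.
Context (d : measure_display) (T : measurableType d) (R : realType).
Context (P : probability T R) (m : nat) (X : 'I_m -> {RV P >-> R}).

Lemma Vvec_gt_event (a : 'rV[R]_m) (t : R) : (forall j, 0 <= a 0 j) -> 1 < t ->
  [set w | forall j, t `^ (a 0 j) < Vvec X w 0 j] =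
  Yvec X @^-1` scale_set (ln t) (open_orthant_above a).
Proof.
move=> a0 t1; rewrite scale_setE ?ln_gt0//.
apply/seteqP; split => w /= H j; have := H j;
  rewrite !mxE powR_lt_inv//; by case/andP: (survival_itv X j w).
Qed.

Lemma Yvec_gt_event (a : 'rV[R]_m) (y : R) : 0 < y ->
  [set w | forall j, y * a 0 j < Yvec X w 0 j] =
  [set w | open_orthant_above a (y^-1 *: Yvec X w)].
Proof.
move=> y0; apply/seteqP; split => w /= H j; have := H j.
  by rewrite [X in _ -> _ < X]mxE mulrC -ltr_pdivlMr// mulrC.
by rewrite [X in _ < X -> _]mxE [X in _ < X -> _]mulrC ltr_pdivlMr// mulrC.
Qed.

Lemma tail_limit_Vvec (I : 'rV[R]_m -> \bar R) (a : 'rV[R]_m) (lambda : R) :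
  (forall j, 0 <= a 0 j) -> 0 < lambda ->
  tail_limit P (Yvec X) I (open_orthant_above a) ->
  (fine (P [set w | forall j : 'I_m, (t * lambda) `^ (a 0 j) < Vvec X w 0 j]) /
   fine (P [set w | forall j : 'I_m, t `^ (a 0 j) < Vvec X w 0 j]))%:E
    @[t --> +oo] --> epow lambda (- inf_on I (open_orthant_above a))%E.
Proof.
move=> a0 l0 /(_ lambda l0); apply: cvg_trans; apply: near_eq_cvg.
near=> t.
have t1 : 1 < t by [].
have tl1 : 1 < t * lambda.
  rewrite -ltr_pdivrMr// div1r; near: t.
  by apply: nbhs_pinfty_gt; exact: num_real.
by rewrite !Vvec_gt_event.
Unshelve. all: by end_near. Qed.

End OrthantProbabilities.

(** * Slowly varying functions in additive form *)

Lemma lebesgue_measure_translate (R : realType) (u : R) (A : set R) : measurable A ->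
  lebesgue_measure [set x | A (x + u)] = lebesgue_measure A.
Proof.
move=> mA; pose shift : R -> measurableTypeR R := fun x => x + u.
have mshift : measurable_fun [set: R] shift by exact: measurable_funD.
suff : pushforward lebesgue_measure shift A = lebesgue_measure A by [].
apply/esym/lebesgue_measure_unique => //= _ [[a b]] _ <-.
rewrite /pushforward.
rewrite (_ : shift @^-1` _ = `]a - u, b - u]%classic); last first.
  by apply/seteqP; split=> x /=; rewrite !in_itv/= ltrBlDr lerBrDr.
rewrite !lebesgue_measure_itv/= !lte_fin ltrD2r.
by case: ifPn => // _; rewrite -!EFinB; congr EFin; ring.
Qed.

(** The uniform convergence theorem, in additive form: if a measurable [k] has
    increments [k (y + u) - k y] tending to [0] for each [u], they do so
    uniformly on compact sets of [u]. *)
Section UniformConvergence.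
Context (R : realType) (k : R -> R).
Hypothesis mk : measurable_fun [set: R] k.
Hypothesis k_slow : forall u, k (y + u) - k y @[y --> +oo] --> (0 : R).

Let mu := @lebesgue_measure R.

Let bad (e y : R) := [set v | 0 <= v <= 2 /\ e <= `|k (y + v) - k y|].

Let mbad e y : measurable (bad e y).
Proof.
rewrite (_ : bad e y = `[0, 2]%classic `&` [set v | e <= `|k (y + v) - k y|]); last first.
  by apply/seteqP; split=> v /=; rewrite in_itv/=.
apply: measurableI => //; apply: measurable_superlevel_ge.
apply: measurableT_comp => //; apply: measurable_funB => //.
apply: measurableT_comp => //; exact: measurable_funD.
Qed.

(** Each [v] lies in only finitely many of the bad sets along [y n --> +oo], so
    their tail unions in [[0, 2]] decrease to the empty set. *)
Lemma slow_bad_small (e : R) (y : nat -> R) (c : \bar R) :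
  0 < e -> y n @[n --> \oo] --> +oo -> (0 < c)%E ->
  \forall n \near \oo, (mu (bad e (y n)) < c)%E.
Proof.
move=> e0 yoo c0; pose D n := bad e (y n).
have D02 n : D n `<=` `[0, 2]%classic by move=> v [v02 _]; rewrite /= in_itv.
have limD : lim_sup_set D = set0.
  apply/seteqP; split=> // v vD.
  have yk : k (y n + v) - k (y n) @[n --> \oo] --> (0 : R).
    exact: (cvg_comp _ _ yoo (k_slow v)).
  have /cvgr0Pnorm_lt/(_ e e0)[N _ HN] := yk.
  have [n /= Nn [_]] := vD N I.
  by rewrite leNgt (HN n Nn).
have : mu (\bigcup_(j >= n) D j) @[n --> \oo] --> 0%E.
  rewrite -(measure0 mu) -limD; apply: lim_sup_set_cvg => [n|]; first exact: mbad.
  apply: (@le_lt_trans _ _ (mu `[0, 2]%classic)); last first.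
    by rewrite /mu lebesgue_measure_itv/= lte_fin ltr0n/= -EFinB ltry.
  apply: le_measure; rewrite ?inE//; first by apply: bigcup_measurable => n _; exact: mbad.
  by apply: bigcup_sub => n _; exact: D02.
move=> H; have : \forall n \near \oo, (mu (\bigcup_(j >= n) D j) < c)%E.
  have Hc : nbhs 0%E [set x : \bar R | (x < c)%E].
    by apply: open_nbhs_nbhs; split=> //; exact: open_ereal_lt_ereal.
  exact: (H _ Hc).
apply: filterS => n; apply: le_lt_trans.
apply: le_measure; rewrite ?inE.
- exact: mbad.
- by apply: bigcup_measurable => j _; exact: mbad.
- by move=> v Dv; exists n => /=.
Qed.

(** Otherwise take [y n --> +oo] and [u n] violating the bound. For large [n],
    the bad sets of [y n] and of [y n + u n] have measure below [1/2], so some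
    [v] in [[1, 2]] is good for [y n] while [v - u n] is good for [y n + u n];
    then [k (y n)] and [k (y n + u n)] are both [e/2]-close to [k (y n + v)]. *)
Lemma slow_uniform (e : R) : 0 < e -> exists Y, forall y u, Y <= y -> 0 <= u <= 1 ->
  `|k (y + u) - k y| <= e.
Proof.
move=> e0; apply: contrapT => /forallNP H.
have e2 : 0 < e / 2 by rewrite divr_gt0.
have : forall n : nat, exists yu : R * R, [/\ n%:R <= yu.1, 0 <= yu.2 <= 1 &
    e < `|k (yu.1 + yu.2) - k yu.1|].
  move=> n; apply: contrapT => /forallNP Hn; apply: (H n%:R) => y u ny u01.
  by rewrite leNgt; apply/negP => ek; apply: (Hn (y, u)).
move=> /choice[f Hf].
have yoo : (f n).1 @[n --> \oo] --> +oo.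
  apply/cvgryPge => A; near=> n; have [+ _ _] := Hf n; apply: le_trans.
  near: n; exact: nbhs_infty_ger.
have zoo : (f n).1 + (f n).2 @[n --> \oo] --> +oo.
  apply/cvgryPge => A; near=> n; have [+ /andP[+ _] _] := Hf n.
  have : A <= n%:R by near: n; exact: nbhs_infty_ger.
  by move=> An fn1 fn2; rewrite (le_trans An)// (le_trans fn1)// lerDl.
have c0 : (0 < (1 / 2 : R)%:E)%E by rewrite lte_fin divr_gt0.
have [n [yn zn]] := filter_ex (filterI (slow_bad_small e2 yoo c0) (slow_bad_small e2 zoo c0)).
have [_] := Hf n; move: yn zn; set y := (f n).1; set u := (f n).2 => yn zn u01 ek.
have mB : measurable [set v | bad (e / 2) (y + u) (v + - u)].
  have : measurable_fun [set: R] (fun v : R => v + - u) by exact: measurable_funD.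
  by move=> /(_ measurableT _ (mbad (e / 2) (y + u))); rewrite setTI.
have cover : `[1, 2]%classic `<=` bad (e / 2) y `|`
    [set v | bad (e / 2) (y + u) (v + - u)].
  move=> v /=; rewrite in_itv/= => /andP[v1 v2]; apply: contrapT => /not_orP[].
  have /andP[u0 u1] := u01.
  move=> /not_andP[|/negP]; first by case; apply/andP; split; lra.
  rewrite -ltNge => b1 /not_andP[|/negP]; first by case; apply/andP; split; lra.
  rewrite -ltNge (_ : y + u + (v + - u) = y + v); last by ring.
  move=> b2; move: ek; rewrite ltNge => /negP; apply.
  rewrite (_ : k (y + u) - k y = (k (y + v) - k y) - (k (y + v) - k (y + u))); last by ring.
  by apply: le_trans (ler_normB _ _) _; rewrite (splitr e) lerD// ltW.
have : (mu `[1%R, 2%R]%classic <= mu (bad (e / 2) y) + mu (bad (e / 2) (y + u)))%E.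
  rewrite -[X in (_ <= _ + X)%E](lebesgue_measure_translate (- u))//.
  apply: (le_trans _ (measureU2 mu (mbad _ _) mB)).
  apply: le_measure; rewrite ?inE; [exact: measurable_itv| |exact: cover].
  exact: (measurableU _ _ (mbad _ _) mB).
rewrite leNgt => /negP; apply.
rewrite /mu lebesgue_measure_itv/= lte_fin ltr1n/= -EFinB.
rewrite (_ : (2 - 1)%:E = (1 / 2)%:E + (1 / 2)%:E)%E; last first.
  by rewrite -EFinD; congr EFin; field.
exact: lteD.
Unshelve. all: by end_near. Qed.

Lemma slow_sublinear : k y / y @[y --> +oo] --> (0 : R).
Proof.
apply/cvgr0Pnorm_le => e e0.
have e2 : 0 < e / 2 by rewrite divr_gt0.
have [Y HY] := slow_uniform e2.
(* Telescoping over n unit steps from Y. *)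
have step n y : Y <= y -> y <= Y + n%:R -> `|k y - k Y| <= e / 2 * n%:R.
  elim: n y => [|n IH] y Yy.
    by rewrite addr0 => yY; rewrite (_ : y = Y) ?subrr ?normr0 ?mulr0//; lra.
  rewrite -natr1 addrA => yn; have [yn'|yn'] := leP y (Y + 1).
    have -> : k y - k Y = k (Y + (y - Y)) - k Y by congr (k _ - _); ring.
    apply: (@le_trans _ _ (e / 2)); first by apply: HY => //; apply/andP; split; lra.
    by apply: ler_peMr; [exact: ltW|rewrite lerDr].
  have -> : k y - k Y = (k (y - 1 + 1) - k (y - 1)) + (k (y - 1) - k Y).
    by rewrite subrK; ring.
  rewrite (le_trans (ler_normD _ _))// mulrDr mulr1 addrC lerD//.
    by apply: IH; lra.
  by apply: HY; [lra|rewrite ler01 lexx].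
near=> y.
have y0 : 0 < y by near: y; apply: nbhs_pinfty_gt; exact: num_real.
have Yy : Y <= y by near: y; apply: nbhs_pinfty_ge; exact: num_real.
have By : (`|k Y| + e / 2 * (1 - Y)) / (e / 2) <= y.
  by near: y; apply: nbhs_pinfty_ge; exact: num_real.
rewrite normrM normfV (gtr0_norm y0) ler_pdivrMr//.
have /truncn_itv/andP[n1 n2] : 0 <= y - Y by rewrite subr_ge0.
have := step (Num.truncn (y - Y)).+1 y Yy.
rewrite -natr1 in n2 *; move=> /(_ ltac:(lra)) kyY.
move: By; rewrite ler_pdivrMr// => By.
have := ler_normD (k y - k Y) (k Y); rewrite subrK.
nra.
Unshelve. all: by end_near. Qed.

End UniformConvergence.

(** * From the tail limit to logarithmic asymptotics *)

Definition rational_box (R : realType) (m : nat) (qn : 'rV[rat]_m * nat) :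
    set 'rV[R]_m :=
  [set x | forall j, `|x 0 j - ratr (qn.1 0 j)| < qn.2.+1%:R^-1].

Arguments rational_box R {m} qn.

Lemma open_rational_boxes (R : realType) (m : nat) (O : set 'rV[R]_m) (x : 'rV[R]_m) :
  open O -> O x -> exists qn, rational_box R qn x /\ rational_box R qn `<=` O.
Proof.
move=> oO Ox.
have /nbhs_ballP[e /= e0 eO] : nbhs x O by apply: open_nbhs_nbhs.
have e2 : 0 < e / 2 by rewrite divr_gt0.
have [n /= en] := filter_ex (near_infty_natSinv_lt (PosNum e2)).
have n0 : 0 < n.+1%:R^-1 :> R by rewrite invr_gt0.
have /choice[q Hq] : forall j, exists q : rat, `|x 0 j - ratr q| < n.+1%:R^-1.
  move=> j; have [|q] := @rat_in_itvoo R (x 0 j - n.+1%:R^-1) (x 0 j + n.+1%:R^-1).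
    by rewrite ltrD2l (lt_trans _ n0)// oppr_lt0.
  rewrite in_itv/= => /andP[q1 q2]; exists q.
  set c := _^-1 in q1 q2 *.
  by rewrite ltr_norml; apply/andP; split; lra.
exists (\row_j q j, n); split; first by move=> j /=; rewrite mxE.
move=> z zq; apply: eO; split=> // i j; rewrite ord1 /ball/=.
have := zq j; rewrite /= mxE => zj; have xj := Hq j.
rewrite (_ : x 0 j - z 0 j = (x 0 j - ratr (q j)) - (z 0 j - ratr (q j))); last by ring.
apply: le_lt_trans (ler_normB _ _) _; rewrite (splitr e).
by apply: ltrD; [exact: lt_trans xj en|exact: lt_trans zj en].
Qed.

(** Every open set of [R^m] is a union of countably many rational boxes, whose
    preimages are finite intersections of conditions on the coordinates. *)
Lemma borel_preimage_measurable (d : measure_display) (U : measurableType d)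
    (R : realType) (m : nat) (f : U -> 'rV[R]_m) (A : set 'rV[R]_m) :
  (forall j, measurable_fun [set: U] (fun w => f w 0 j)) -> borel A ->
  measurable (f @^-1` A).
Proof.
move=> mf; move: A.
suff : <<s @open 'rV[R]_m >> `<=` [set A | measurable (f @^-1` A)] by [].
apply: smallest_sub.
  split => [|A mA|F mF] /=.
  - by rewrite preimage_set0.
  - by rewrite setTD preimage_setC; exact: measurableC.
  - by rewrite preimage_bigcup; apply: bigcup_measurable => k _; exact: mF.
move=> O oO /=.
pose F (qn : 'rV[rat]_m * nat) : set U :=
  if `[< rational_box R qn `<=` O >] then f @^-1` rational_box R qn else set0.
have -> : f @^-1` O = \bigcup_qn F qn.
  apply/seteqP; split => [w Ow|w [qn _]].
    have [qn [xq qO]] := open_rational_boxes oO Ow.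
    by exists qn => //; rewrite /F asboolT.
  by rewrite /F; case: asboolP => // qO /qO.
apply: countable_bigcupT_measurable; first exact: countableP.
move=> qn; rewrite /F; case: ifP => // _.
rewrite (_ : _ @^-1` _ = \bigcap_(j in [set: 'I_m])
    [set w | `|f w 0 j - ratr (qn.1 0 j)| < qn.2.+1%:R^-1]); last first.
  by apply/seteqP; split=> w /=; [move=> H j _; exact: H|move=> H j; exact: H].
apply: fin_bigcap_measurable; first exact: finite_finset.
move=> j _.
have mg : measurable_fun [set: U] (fun w => `|f w 0 j - ratr (qn.1 0 j)|).
  by apply: measurableT_comp => //; exact: measurable_funB.
have := mg measurableT _ (measurable_itv `]-oo, qn.2.+1%:R^-1[).
by rewrite setTI; congr measurable; apply/seteqP; split=> w /=; rewrite in_itv.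
Qed.

(** The event [A (c y *: Y w)] is measurable jointly in [(w, y)]; its sections
    have measurable probability. *)
Lemma measurable_scaled_probability (d : measure_display) (T : measurableType d)
    (R : realType) (P : probability T R) (m : nat) (Y : T -> 'rV[R]_m)
    (A : set 'rV[R]_m) (c : R -> R) :
  (forall j, measurable_fun [set: T] (fun w => Y w 0 j)) ->
  measurable_fun [set: R] c -> borel A ->
  measurable_fun [set: R] (fun y => fine (P [set w | A (c y *: Y w)])).
Proof.
move=> mY mc bA.
pose f (wy : T * R) := c wy.2 *: Y wy.1.
have mf : measurable (f @^-1` A).
  apply: borel_preimage_measurable => // j.
  rewrite /f; under eq_fun do rewrite mxE.
  apply: measurable_funM; first by apply: measurableT_comp => //; exact: measurable_snd.
  by apply: (measurableT_comp (mY j)); exact: measurable_fst.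
have := measurable_fun_ysection P mf => H.
apply: (measurableT_comp (fine_measurable measurableT)).
apply: eq_measurable_fun H => y _ /=.
by congr (P _); apply/seteqP; split=> w; rewrite /ysection/= inE.
Qed.

(** The limit relation makes [k y = log P(Y \in y A) + s y] slowly varying in
    additive form, so [k y / y --> 0]. *)
Lemma tail_limit_log (d : measure_display) (T : measurableType d) (R : realType)
  (P : probability T R) (m : nat) (Y : T -> 'rV[R]_m) (I : 'rV[R]_m -> \bar R)
  (A : set 'rV[R]_m) :
  (forall j, measurable_fun [set: T] (fun w => Y w 0 j)) -> borel A ->
  inf_on I A \is a fin_num -> tail_limit P Y I A ->
  (y^-1%:E * lne (P (Y @^-1` scale_set y A)))%E @[y --> +oo] --> (- inf_on I A)%E.
Proof.
move=> mY bA fs tl; set s := inf_on I A in fs tl *.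
pose r := fine s; have sE : s = r%:E by rewrite fineK.
(* expR (- ln y) agrees with y^-1 for y > 0 and is visibly measurable in y. *)
pose g y := fine (P [set w | A (expR (- ln y) *: Y w)]).
have gE y : 0 < y -> fine (P (Y @^-1` scale_set y A)) = g y.
  by move=> y0; rewrite scale_setE// /g expRN lnK.
have ratio u : g (y + u) / g y @[y --> +oo] --> expR (- r * u).
  have expoo : (expR y : R) @[y --> +oo] --> +oo.
    apply/cvgryPge => B; near=> y; rewrite (le_trans _ (expR_ge1Dx y))//.
    rewrite -lerBlDl; near: y; apply: nbhs_pinfty_ge; exact: num_real.
  have := tl (expR u) (expR_gt0 u).
  rewrite /epow -/s sE -EFinN expRK -EFinM /= => H.
  have {}H : fine (P (Y @^-1` scale_set (ln (expR y * expR u)) A)) /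
      fine (P (Y @^-1` scale_set (ln (expR y)) A)) @[y --> +oo] --> expR (- r * u).
    exact: (fine_cvg (cvg_comp _ _ expoo H)).
  apply: cvg_trans H; apply: near_eq_cvg; near=> y => /=.
  rewrite -expRD !expRK !gE//.
  rewrite -ltrBlDr sub0r; near: y; apply: nbhs_pinfty_gt; exact: num_real.
have g_gt0 : \forall y \near +oo, 0 < g y.
  (* A vanishing denominator would make the ratio 0, whereas it tends to 1. *)
  have r0 := ratio 0; rewrite mulr0 expR0 in r0.
  have H : \forall y \near +oo, 0 < g (y + 0) / g y.
    exact: (cvgr_gt _ r0 _ (ltr01 : (0 : R) < 1)).
  apply: filterS H => y; rewrite addr0 => H.
  have gy0 : 0 <= g y by exact: fine_ge0.
  rewrite lt_neqAle gy0 andbT; apply/eqP => g0.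
  by move: H; rewrite -g0 mul0r ltxx.
pose k y := ln (g y) + r * y.
have mk : measurable_fun [set: R] k.
  apply: measurable_funD; last exact: measurable_funM.
  apply: measurableT_comp => //; apply: measurable_scaled_probability => //.
  by apply: measurableT_comp => //; apply: measurableT_comp.
have kslow u : k (y + u) - k y @[y --> +oo] --> (0 : R).
  have L : ln (g (y + u) / g y) @[y --> +oo] --> - r * u.
    rewrite -[X in _ --> X]expRK; apply: continuous_cvg (ratio u).
    by apply: continuous_ln; exact: expR_gt0.
  have {}L : ln (g (y + u) / g y) + r * u @[y --> +oo] --> - r * u + r * u.
    by apply: cvgD L _; exact: cvg_cst.
  rewrite mulNr addNr in L; apply: cvg_trans L; apply: near_eq_cvg.
  have g_gt0u : \forall y \near +oo, 0 < g (y + u).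
    exact: (@cvg_addrr R u _ g_gt0).
  near=> y.
  have gy : 0 < g y by near: y.
  have gyu : 0 < g (y + u) by near: y.
  by rewrite ln_div// /k; ring.
have K := slow_sublinear mk kslow.
rewrite sE -EFinN.
apply: (@cvg_trans _ ((k y / y - r)%:E @[y --> +oo])).
  apply: near_eq_cvg; near=> y.
  have y0 : 0 < y by near: y; apply: nbhs_pinfty_gt; exact: num_real.
  have gy : 0 < g y by near: y.
  have mS : measurable (Y @^-1` scale_set y A).
    rewrite scale_setE//.
    apply: (@borel_preimage_measurable _ _ _ _ (fun w => y^-1 *: Y w)) => // j.
    by under eq_fun do rewrite mxE; exact: measurable_funM.
  have -> : P (Y @^-1` scale_set y A) = (g y)%:E by rewrite -gE// fineK// fin_num_measure.
  rewrite lne_EFin// -EFinM /k; congr EFin; field.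
  by rewrite gt_eqF.
apply: cvg_EFin; first exact: nearW.
by rewrite -[X in _ --> X](add0r (- r)); apply: cvgB K _; exact: cvg_cst.
Unshelve. all: by end_near. Qed.

Unset Implicit Arguments.

Theorem theorem3 (d : measure_display) (T : measurableType d) (R : realType)
  (P : probability T R) (m : nat) (hm : (0 < m)%N)
  (X : 'I_m -> {RV P >-> R}) (I : 'rV[R]_m -> \bar R)
  (hF : forall j : 'I_m, continuous (cdf (X j)))
  (hI : rate_function I)
  (hIneg : forall x : 'rV[R]_m, (exists j : 'I_m, x 0 j < 0) -> I x = +oo%E) :
  (* (a) *)
  (LDP P (Yvec X) I ->
    [/\ forall A : set 'rV[R]_m, borel A -> continuity_set I A ->
          von_mises (fun y => (- lne (P [set w | A (y^-1 *: Yvec X w)]))%E) ->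
          tail_limit P (Yvec X) I A,
        forall (lambda : R) (x : 'rV[R]_m), 0 < lambda ->
          I (lambda *: x) = (lambda%:E * I x)%E,
        forall (lambda : R) (j : 'I_m), 0 <= lambda ->
          inf_on I [set x : 'rV[R]_m | lambda < x 0 j] = lambda%:E,
        I 0 = 0%E
      & forall a : 'rV[R]_m, (forall j : 'I_m, 0 <= a 0 j) ->
          ((exists j : 'I_m, a 0 j = 0) ->
            continuity_set I (open_orthant_above a)) ->
          von_mises (fun y => (- lne (P [set w | forall j : 'I_m,
                                           (y * a 0 j < Yvec X w 0 j)%R]))%E) ->
          forall lambda : R, 0 < lambda ->
            (fine (P [set w | forall j : 'I_m,
                        (t * lambda) `^ (a 0 j) < Vvec X w 0 j]) /
             fine (P [set w | forall j : 'I_m,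
                        t `^ (a 0 j) < Vvec X w 0 j]))%:E
              @[t --> +oo] -->
            epow lambda (- inf_on I (open_orthant_above a))%E])
  /\
  (* (b) *)
  (forall A : set 'rV[R]_m, borel A ->
    (0 < inf_on I A)%E -> (inf_on I A < +oo)%E ->
    tail_limit P (Yvec X) I A ->
    (y^-1%:E * lne (P (Yvec X @^-1` scale_set y A)))%E @[y --> +oo] -->
      (- inf_on I A)%E).
Proof.
split; last first.
  move=> A bA s0 sy tl; apply: tail_limit_log => //.
    by move=> j; exact: measurable_Yvec.
  by rewrite ge0_fin_numE// ltW.
move=> HL.
have tailA (A : set 'rV[R]_m) : borel A -> continuity_set I A ->
    von_mises (fun y => (- lne (P [set w | A (y^-1 *: Yvec X w)]))%E) ->
    tail_limit P (Yvec X) I A.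
  move=> bA cA; apply: tail_limit_von_mises; first exact: hI.1.
  by apply: LDP_continuity_set => //; [exact: Yvec_orthant|exact: rate_out_orthant].
have hom := rate_homogeneous hI hIneg HL.
split=> //.
- by move=> lambda j; exact: rate_inf_halfspace.
- exact: (rate0 hF hI hIneg HL).
- move=> a a0 ca vm lambda l0; apply: tail_limit_Vvec => //.
  apply: tailA.
  + by apply: borel_open; exact: open_orthant_above_open.
  + have [[j /eqP aj]|/forallNP aN0] := pselect (exists j, a 0 j == 0).
      by apply: ca; exists j.
    apply: continuity_set_orthant_above => //; first exact: hI.1.
    by move=> j; rewrite lt_neqAle a0 andbT eq_sym; apply/negP/aN0.
  + by apply: eq_von_mises vm => y y0; rewrite Yvec_gt_event.
Qed.
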